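(* Let $E,F\subset\mathbb{C}$ be compact and $K=E\times F\subset\mathbb{C}^2$. Let $a,b>0$ and let $C=T_{a,b}$ be the triangle with vertices $(0,0),(b,0),(0,a)$. Then $$-\log\delta_C(K)=\frac{ab}{a+b}\Big(\frac{-\log D(E)}{a}+\frac{-\log D(F)}{b}\Big),\quad\text{i.e.}\quad \delta_C(K)=D(E)^{b/(a+b)}D(F)^{a/(a+b)},$$ where $D(E),D(F)$ denote the univariate transfinite diameters (logarithmic capacities) of $E,F$.
   Context: For a convex body $C\subset(\mathbb{R}^+)^2$ and $n\ge1$, $\mathrm{Poly}(nC)$ is the span of the monomials $z^J$, $J\in nC\cap\mathbb{N}^2$, with dimension $d_n$ and monomials $z^{\alpha(j)}$, $j=1,\dots,d_n$. Let $V_n(K)=\max_{\zeta_1,\dots,\zeta_{d_n}\in K}|\det[\zeta_j^{\alpha(i)}]_{i,j=1}^{d_n}|$ and $l_n=\sum_{j=1}^{d_n}|\alpha(j)|$. The $C$-transfinite diameter is $\delta_C(K)=\limsup_n V_n(K)^{1/l_n}$ (known to be a limit). *)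

(* Defs.v *)
From mathcomp Require Import all_boot all_order all_algebra.
From mathcomp Require Import all_classical all_reals all_analysis.
From mathcomp Require Import complex.
Set Implicit Arguments. Unset Strict Implicit. Unset Printing Implicit Defensive.
Import Order.TTheory GRing.Theory Num.Theory numFieldNormedType.Exports.
Local Open Scope classical_set_scope.
Local Open Scope ring_scope.

Section Defs.
Variable R : realType.

Definition cabs (z : R[i]) : R :=
  Num.sqrt (complex.Re z ^+ 2 + complex.Im z ^+ 2).

Definition ccompact (E : set R[i]) : Prop :=
  @compact (R * R)%type [set (complex.Re z, complex.Im z) | z in E].

Definition vdm_prod (n : nat) (z : 'I_n -> R[i]) : R :=
  \prod_(i < n) \prod_(j < n | (i < j)%N) cabs (z i - z j).

(* V_n(E) = max_{z_1..z_n in E} prod_{i<j} |z_i - z_j|  (sup; = max for compact E) *)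
Definition Vuni (E : set R[i]) (n : nat) : R :=
  sup [set vdm_prod z | z in [set z : 'I_n -> R[i] | forall i, E (z i)]].

(* D(E) = limsup_n V_n(E)^(2/(n(n-1))) (classically a limit) *)
Definition tdiam (E : set R[i]) : \bar R :=
  limn_esup (fun n => ((Vuni E n) `^ (2 / (n * (n - 1))%:R))%:E).

Definition scaleset (n : nat) (C : set (R * R)) : set (R * R) :=
  [set (n%:R * c.1, n%:R * c.2) | c in C].

(* the exponents J in nC ∩ N^2, enumerated inside the box [0,B)^2
   (B must be chosen so that the box contains nC ∩ N^2) *)
Definition lattice_exps (C : set (R * R)) (B n : nat) : seq (nat * nat) :=
  [seq J <- [seq (i, j) | i <- iota 0 B, j <- iota 0 B]
     | `[< scaleset n C (J.1%:R, J.2%:R) >]].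

Definition cmono (J : nat * nat) (z : R[i] * R[i]) : R[i] :=
  z.1 ^+ J.1 * z.2 ^+ J.2.

Definition Vmulti (al : seq (nat * nat)) (K : set (R[i] * R[i])) : R :=
  sup [set cabs (\det (\matrix_(i < size al, j < size al)
                         cmono (nth (0%N, 0%N) al i) (zeta j)))
      | zeta in [set zeta : 'I_(size al) -> R[i] * R[i] | forall j, K (zeta j)]].

Definition lsum (al : seq (nat * nat)) : nat := \sum_(J <- al) (J.1 + J.2)%N.

Definition deltaC (C : set (R * R)) (B : nat -> nat) (K : set (R[i] * R[i])) : \bar R :=
  limn_esup (fun n => ((Vmulti (lattice_exps C (B n) n) K)
                         `^ ((lsum (lattice_exps C (B n) n))%:R)^-1)%:E).

Definition triangle (a b : R) : set (R * R) :=
  [set p | 0 <= p.1 /\ 0 <= p.2 /\ p.1 / b + p.2 / a <= 1].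

(* a box bound: n T_{a,b} ∩ N^2 ⊆ [0, B n)^2 since coordinates are <= n (a+b) *)
Definition tri_box (a b : R) (n : nat) : nat := (Num.truncn (n%:R * (a + b))).+1.

End Defs.

(* Main.v *)
Require Import Defs.
From mathcomp Require Import all_boot all_order all_algebra.
From mathcomp Require Import all_classical all_reals all_analysis.
From mathcomp Require Import complex ring lra zify.
Import Order.TTheory GRing.Theory Num.Theory numFieldNormedType.Exports.
Local Open Scope classical_set_scope.
Local Open Scope ring_scope.

(* Let [tau_k(E)] be the least sup norm on [E] of a monic polynomial of degree
   [k], and [tau(E)] the infimum of the [tau_k(E) ^ (1/k)].  Adjoining one more
   function and one more point to a determinant [det f_i(z_j)] multiplies its
   maximal modulus by the Chebyshev number of the new function modulo the span of
   the previous ones, up to a factor at most the number of points.  For the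
   exponents of [n T_{a,b}], enumerated lexicographically, the Chebyshev number of
   [x^k y^l] on [E * F] is [tau_k(E) tau_l(F)]: the upper bound uses that the set
   of exponents is a lower set, the lower bound views a competitor as a polynomial
   in [x] whose leading coefficient is monic of degree [l] in [y].  Since
   [tau(E)^k <= tau_k(E) <= C r^k] for every [r > tau(E)], with
   [d_n = O(n^2)] and [l_n] of order [n^3] the constants and factorials disappear
   in the [l_n]-th root, and the exponents of [tau(E)] and [tau(F)] converge to
   [b/(a+b)] and [a/(a+b)].  The same argument in one variable shows that [D(E)]
   is [tau(E)]. *)

(** * Maximal generalized Vandermonde determinants *)

Section DeterminantBounds.
Set Implicit Arguments.
Unset Strict Implicit.
Variable R : realType.
Implicit Types (x y : R[i]).

Lemma cabsE (z : R[i]) : cabs z = complex.Re `|z|.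
Proof. by rewrite normc_def. Qed.

Lemma cabs_norm (z : R[i]) : (cabs z)%:C%C = `|z|.
Proof. by rewrite normc_def. Qed.

Lemma cabsM x y : cabs (x * y) = cabs x * cabs y.
Proof. by apply: (@complexI R); rewrite rmorphM /= !cabs_norm normrM. Qed.

Lemma cabs_ge0 (z : R[i]) : 0 <= cabs z.
Proof. exact: sqrtr_ge0. Qed.

Lemma cabs0 : cabs (0 : R[i]) = 0.
Proof. by rewrite /cabs /= expr0n addr0 sqrtr0. Qed.

Lemma cabs1 : cabs (1 : R[i]) = 1.
Proof. by rewrite cabsE normr1. Qed.

Lemma cabsN x : cabs (- x) = cabs x.
Proof. by rewrite !cabsE normrN. Qed.

Lemma cabs_eq0 x : (cabs x == 0) = (x == 0).
Proof.
apply/eqP/eqP => [h|->]; last exact: cabs0.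
by apply/eqP; rewrite -normr_eq0 -cabs_norm h.
Qed.

Lemma cabsX x n : cabs (x ^+ n) = cabs x ^+ n.
Proof. by elim: n => [|n IH]; rewrite ?expr0 ?cabs1 // !exprS cabsM IH. Qed.

Lemma ler_cabsD x y : cabs (x + y) <= cabs x + cabs y.
Proof. by rewrite -lecR rmorphD /= !cabs_norm ler_normD. Qed.

Lemma ler_cabs_sum I (r : seq I) (P : pred I) (F : I -> R[i]) :
  cabs (\sum_(i <- r | P i) F i) <= \sum_(i <- r | P i) cabs (F i).
Proof.
elim/big_rec2: _ => [|i y z _ h]; first by rewrite cabs0.
by apply: le_trans (ler_cabsD _ _) _; rewrite lerD2l.
Qed.

Lemma cabs_prod I (r : seq I) (P : pred I) (F : I -> R[i]) :
  cabs (\prod_(i <- r | P i) F i) = \prod_(i <- r | P i) cabs (F i).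
Proof. by apply: (big_morph _ cabsM cabs1). Qed.

Variable T : Type.
Implicit Types (f : nat -> T -> R[i]) (K : set T).

Definition evalmx f m (zeta : 'I_m -> T) : 'M[R[i]]_m :=
  \matrix_(i < m, j < m) f i (zeta j).

(** Both [Vuni] and [Vmulti] are instances, for powers of one variable and for listed monomials, so
    the same estimates serve both. *)
Definition maxdet f K m : R :=
  sup [set cabs (\det (evalmx f zeta))
      | zeta in [set zeta : 'I_m -> T | forall j, K (zeta j)]].

(** Adding combinations of the earlier rows to the last row does not change the determinant.
    Expanding along the new last row leaves [m.+1] terms, each an entry at most [s] times a cofactor
    that is up to sign a determinant on the other [m] points. *)
Lemma det_evalmx_step f K m (c : nat -> R[i]) (s v : R) :
  (forall z, K z -> cabs (f m z + \sum_(i < m) c i * f i z) <= s) ->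
  (forall zeta : 'I_m -> T, (forall j, K (zeta j)) ->
     cabs (\det (evalmx f zeta)) <= v) ->
  forall zeta : 'I_m.+1 -> T, (forall j, K (zeta j)) ->
  cabs (\det (evalmx f zeta)) <= m.+1%:R * (s * v).
Proof.
move=> hs hv zeta Kz; set M := evalmx f zeta.
(* An earlier row paired with the cofactors of the last row is an off-diagonal entry of [M] times
   its adjugate. *)
have row_vanish (i : 'I_m) :
    \sum_j f i (zeta j) * cofactor M ord_max j = 0.
  have /matrixP/(_ (widen_ord (leqnSn m) i) ord_max) := mul_mx_adj M.
  rewrite !mxE /= -val_eqE /= ltn_eqF ?mulr0n //= => H.
  by rewrite -[RHS]H; apply: eq_bigr => j _; rewrite !mxE.
have -> : \det M = \sum_j (f m (zeta j) + \sum_(i < m) c i * f i (zeta j))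
                     * cofactor M ord_max j.
  rewrite (expand_det_row M ord_max).
  under [RHS]eq_bigr => j _ do rewrite mulrDl mulr_suml.
  rewrite big_split /= exchange_big /= [X in _ + X]big1 ?addr0.
    by apply: eq_bigr => j _; rewrite mxE.
  move=> i _; under eq_bigr => j _ do rewrite -mulrA.
  by rewrite -mulr_sumr row_vanish mulr0.
apply: le_trans (ler_cabs_sum _ _ _) _.
have -> : m.+1%:R * (s * v) = \sum_(j < m.+1) (s * v).
  by rewrite sumr_const card_ord mulr_natl.
apply: ler_sum => j _; rewrite cabsM; apply: ler_pM; rewrite ?cabs_ge0 ?hs //.
rewrite /cofactor cabsM cabsX cabsN cabs1 expr1n mul1r.
have -> : row' ord_max (col' j M) = evalmx f (fun k => zeta (lift j k)).
  by apply/matrixP => k l; rewrite !mxE lift_max.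
by apply: hv.
Qed.

(** Functions are peeled off from the last; the factors [m.+1] of the single steps accumulate to the
    factorial. *)
Lemma det_evalmx_upper f K (s : nat -> R) m :
  (forall i, (i < m)%N -> exists c : nat -> R[i], forall z, K z ->
     cabs (f i z + \sum_(k < i) c k * f k z) <= s i) ->
  forall zeta : 'I_m -> T, (forall j, K (zeta j)) ->
  cabs (\det (evalmx f zeta)) <= m`!%:R * \prod_(i < m) s i.
Proof.
elim: m => [_ zeta _|m IH hs zeta Kz].
  by rewrite det_mx00 cabs1 big_ord0 mulr1.
have [c hc] := hs m (ltnSn m).
apply: le_trans (det_evalmx_step hc (IH _) Kz) _; first by move=> i im; apply: hs; exact: ltnW.
by rewrite big_ord_recr /= factS natrM le_eqVlt; apply/orP; left; apply/eqP; ring.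
Qed.

Definition bounded_on (K : set T) (g : T -> R[i]) :=
  exists M, forall z, K z -> cabs (g z) <= M.

Lemma maxdet_has_ubound f K m : (forall i, (i < m)%N -> bounded_on K (f i)) ->
  has_ubound [set cabs (\det (evalmx f zeta))
      | zeta in [set zeta : 'I_m -> T | forall j, K (zeta j)]].
Proof.
move=> hf.
have /choice[s hs] : forall i, exists M, (i < m)%N -> forall z, K z -> cabs (f i z) <= M.
  move=> i; case: (ltnP i m) => im; last by exists 0.
  by have [M hM] := hf i im; exists M.
exists (m`!%:R * \prod_(i < m) s i) => _ [zeta Kz <-].
apply: (det_evalmx_upper (K := K)) => // i im; exists (fun=> 0) => z Kz'.
by rewrite big1 ?addr0 ?hs // => k _; rewrite mul0r.
Qed.

Lemma maxdet_upper f K (s : nat -> R) m : (exists z, K z) ->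
  (forall i, (i < m)%N -> exists c : nat -> R[i], forall z, K z ->
     cabs (f i z + \sum_(k < i) c k * f k z) <= s i) ->
  maxdet f K m <= m`!%:R * \prod_(i < m) s i.
Proof.
move=> [z0 Kz0] hs; apply: ge_sup.
  by exists (cabs (\det (evalmx f (fun _ : 'I_m => z0)))), (fun=> z0).
by move=> _ [zeta Kz <-]; exact: det_evalmx_upper Kz.
Qed.

(** The free point [z] occurs only in the last column; expanding along it gives a combination of the
    [f i z] whose top coefficient is the old determinant. *)
Lemma det_extend f m (zeta : 'I_m -> T) : exists c : nat -> R[i], forall z,
  \det (evalmx f (fun j : 'I_m.+1 => oapp zeta z (unlift ord_max j))) =
  f m z * \det (evalmx f zeta) + \sum_(i < m) c i * f i z.
Proof.
pose ext z := fun j : 'I_m.+1 => oapp zeta z (unlift ord_max j).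
(* the cofactors along the last column do not involve the last point *)
pose c (i : 'I_m.+1) : R[i] := (-1) ^+ (i + m) *
  \det (\matrix_(k < m, l < m) f (lift i k) (zeta l)).
exists (fun n => if insub n is Some i then c i else 0) => z.
rewrite (expand_det_col _ ord_max).
have cofE i : cofactor (evalmx f (ext z)) i ord_max = c i.
  rewrite /cofactor /c; congr (_ * \det _).
  by apply/matrixP => k l; rewrite !mxE /ext liftK.
rewrite big_ord_recr /= addrC; congr (_ + _).
  rewrite mxE unlift_none /= -/(ext z) cofE /c addnn -signr_odd odd_double expr0 mul1r.
  by congr (_ * \det _); apply/matrixP => k l; rewrite !mxE lift_max.
apply: eq_bigr => i _; rewrite -/(ext z) cofE mxE /ext unlift_none /= mulrC.
case: insubP => [u _ uE|]; last by rewrite ltnS ltnW.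
by congr (c _ * _); apply: val_inj; rewrite /= uE.
Qed.

(** Divided by the old determinant, the extended one becomes [f m] plus a combination of earlier
    functions in the free point, so any bound for it on [K] is at least [t]. *)
Lemma maxdet_lower_step f K m (t : R) :
  (forall i, (i < m.+1)%N -> bounded_on K (f i)) -> (exists z, K z) ->
  (forall (c : nat -> R[i]) (y : R),
     (forall z, K z -> cabs (f m z + \sum_(k < m) c k * f k z) <= y) -> t <= y) ->
  forall zeta : 'I_m -> T, (forall j, K (zeta j)) ->
  cabs (\det (evalmx f zeta)) * t <= maxdet f K m.+1.
Proof.
move=> hf [z0 Kz0] ht zeta Kz.
have detle (xi : 'I_m.+1 -> T) : (forall j, K (xi j)) ->
    cabs (\det (evalmx f xi)) <= maxdet f K m.+1.
  by move=> Kxi; apply: ub_le_sup; [exact: maxdet_has_ubound|exists xi].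
(* If the determinant vanishes, only nonnegativity of [maxdet] is left, witnessed by a constant
   tuple. *)
have [/eqP|dn0] := eqVneq (cabs (\det (evalmx f zeta))) 0.
  move=> /eqP->; rewrite mul0r; apply: le_trans (detle (fun=> z0) _) => //.
  exact: cabs_ge0.
have dgt0 : 0 < cabs (\det (evalmx f zeta)) by rewrite lt_def dn0 cabs_ge0.
have [c hc] := det_extend f zeta.
rewrite mulrC -ler_pdivlMr //.
apply: (ht (fun i => c i / \det (evalmx f zeta))) => z Kz'.
rewrite ler_pdivlMr // -cabsM.
have Kext (j : 'I_m.+1) : K (oapp zeta z (unlift ord_max j)) by case: (unlift _ _) => [k|] /=.
apply: le_trans (detle _ Kext); rewrite hc mulrDl mulr_suml le_eqVlt.
apply/orP; left; apply/eqP; congr (cabs (_ + _)); apply: eq_bigr => i _.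
by rewrite mulrAC divfK // -cabs_eq0.
Qed.

Lemma maxdet_lower f K (t : nat -> R) m :
  (forall i, bounded_on K (f i)) -> (exists z, K z) -> (forall i, 0 <= t i) ->
  (forall i, (i < m)%N -> forall (c : nat -> R[i]) (y : R),
     (forall z, K z -> cabs (f i z + \sum_(k < i) c k * f k z) <= y) -> t i <= y) ->
  \prod_(i < m) t i <= maxdet f K m.
Proof.
move=> hf K0 t0; have [z0 Kz0] := K0.
elim: m => [_|m IH ht].
  rewrite big_ord0; apply: ub_le_sup; first exact: maxdet_has_ubound.
  by exists (fun=> z0) => //; rewrite det_mx00 cabs1.
rewrite big_ord_recr /=.
have step : forall zeta : 'I_m -> T, (forall j, K (zeta j)) ->
    cabs (\det (evalmx f zeta)) * t m <= maxdet f K m.+1.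
  by apply: maxdet_lower_step => // c y; exact: ht.
(* Passing from single tuples to their supremum divides by [t m], hence the separate zero case. *)
have [tm0|tm_neq0] := eqVneq (t m) 0.
  rewrite tm0 mulr0; apply: le_trans (step (fun=> z0) _) => //.
  by rewrite tm0 mulr0.
have tm_gt0 : 0 < t m by rewrite lt_def tm_neq0 t0.
rewrite -ler_pdivlMr //; apply: le_trans (IH _) _.
  by move=> i im; apply: ht; exact: ltnW.
apply: ge_sup; first by exists (cabs (\det (evalmx f (fun _ : 'I_m => z0)))), (fun=> z0).
by move=> _ [zeta Kz <-]; rewrite ler_pdivlMr // step.
Qed.

End DeterminantBounds.

(** * The Chebyshev constant *)

Section ChebyshevConstant.
Set Implicit Arguments.
Unset Strict Implicit.
Variable R : realType.
Implicit Types (E : set R[i]) (p : {poly R[i]}).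

(** Comparing with [x ^+ k] avoids extracting roots: the infimum of these radii is the infimum over
    [k] of the [k]-th roots of the Chebyshev numbers. *)
Definition cheb_radii E : set R :=
  [set x | 0 <= x /\ exists k p, [/\ (0 < k)%N, p \is monic, size p = k.+1 &
     forall z, E z -> cabs p.[z] <= x ^+ k]].

Definition cheb E : R := inf (cheb_radii E).

Lemma cheb_radii_lb E : has_lbound (cheb_radii E).
Proof. by exists 0 => x []. Qed.

Lemma cheb_radii_neq0 E : bounded_on E id -> cheb_radii E !=set0.
Proof.
move=> [M hM]; exists `|M|; split; first exact: normr_ge0.
exists 1%N, 'X; split; rewrite ?monicX ?size_polyX // => z Ez.
by rewrite hornerX expr1; apply: le_trans (hM z Ez) (ler_norm _).
Qed.

Lemma cheb_ge0 E : bounded_on E id -> 0 <= cheb E.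
Proof. by move=> bE; apply: lb_le_inf; [exact: cheb_radii_neq0|move=> x []]. Qed.

Lemma cheb_le E k p (y : R) : bounded_on E id -> (exists z, E z) ->
  p \is monic -> size p = k.+1 -> (forall z, E z -> cabs p.[z] <= y) ->
  cheb E ^+ k <= y.
Proof.
move=> bE [z0 Ez0] pmon psz hy.
have y0 : 0 <= y by apply: le_trans (hy _ Ez0); exact: cabs_ge0.
(* Radii require positive degree. In degree 0 the polynomial is 1, and a point of [E] gives
   [1 <= y]; otherwise the root of [y] is itself a radius. *)
case: k psz => [|k] psz.
  have p1 : p = 1%:P.
    rewrite (size1_polyC (p := p)) ?psz //; congr (_%:P).
    by move/monicP: pmon; rewrite lead_coefE psz.
  by have := hy _ Ez0; rewrite p1 hornerC cabs1 expr0.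
have yE : y = (y `^ (k.+1%:R^-1)) ^+ k.+1.
  by rewrite -powR_mulrn ?powR_ge0 // -powRrM mulVf ?powRr1 // pnatr_eq0.
rewrite yE; apply: lerXn2r; rewrite ?nnegrE ?powR_ge0 ?cheb_ge0 //.
apply: ge_inf; first exact: cheb_radii_lb.
by split; [exact: powR_ge0|exists k.+1, p; rewrite -yE].
Qed.

(** Take [p] of degree [k] with radius below [r], and divide [m] by [k]: a power of [p] times
    ['X^(m %% k)] has degree [m], and the remainder, being below [k], costs only a constant. *)
Lemma cheb_gt E (r : R) : bounded_on E id -> cheb E < r ->
  exists2 C : R, 1 <= C & forall m, exists p,
    [/\ p \is monic, size p = m.+1 & forall z, E z -> cabs p.[z] <= C * r ^+ m].
Proof.
move=> bE rE; have r_gt0 : 0 < r by apply: le_lt_trans rE; exact: cheb_ge0.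
have [x [x0 [k [p [k0 pmon psz hp]]]] xr] := inf_lt (cheb_radii_neq0 bE) rE.
(* Chosen so that [1 <= A] and [cabs z <= A * r] on [E]; then [A ^+ k] absorbs the remainder
   power. *)
have [M hM] := bE; pose A := 1 + `|M| / r.
have A1 : 1 <= A by rewrite lerDl divr_ge0 ?(ltW r_gt0).
exists (A ^+ k) => [|m]; first exact: exprn_ege1.
exists (p ^+ (m %/ k) * 'X^(m %% k)).
have pqmon : p ^+ (m %/ k) \is monic by exact: monic_exp.
split=> [||z Ez].
- by rewrite monicMr ?monicXn.
- rewrite size_monicM ?monicXn ?size_polyXn //; last by rewrite -size_poly_eq0 size_polyXn.
  by rewrite addnS /= polySpred ?monic_neq0 // size_exp psz /= mulnC addSn -divn_eq.
rewrite hornerM horner_exp hornerXn cabsM !cabsX.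
have -> : r ^+ m = (r ^+ k) ^+ (m %/ k) * r ^+ (m %% k).
  by rewrite -exprM -exprD mulnC -divn_eq.
rewrite mulrCA; apply: ler_pM; rewrite ?exprn_ge0 ?cabs_ge0 //.
  apply: lerXn2r; rewrite ?nnegrE ?cabs_ge0 ?exprn_ge0 ?(ltW r_gt0) //.
  by apply: le_trans (hp z Ez) _; apply: lerXn2r; rewrite ?nnegrE ?(ltW r_gt0) // ltW.
have zA : cabs z <= A * r.
  rewrite mulrDl mul1r divfK ?gt_eqF //; apply: le_trans (hM z Ez) _.
  by apply: le_trans (ler_norm _) _; rewrite lerDr ltW.
apply: (@le_trans _ _ ((A * r) ^+ (m %% k))).
  by apply: lerXn2r; rewrite ?nnegrE ?cabs_ge0 ?mulr_ge0 ?(ltW r_gt0) ?(le_trans ler01).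
rewrite exprMn ler_wpM2r ?exprn_ge0 ?(ltW r_gt0) //.
by apply: ler_weXn2l => //; rewrite ltnW // ltn_mod.
Qed.

End ChebyshevConstant.

(** * Determinants of monomials on a product set *)

Section BidegreeLists.
Set Implicit Arguments.
Unset Strict Implicit.
Variable R : realType.
Implicit Types (E F : set R[i]) (J : nat * nat) (al : seq (nat * nat)).

(** This is the order in which [lattice_exps] enumerates exponents. *)
Definition lexlt J J' := (J.1 < J'.1)%N || (J.1 == J'.1) && (J.2 < J'.2)%N.

Lemma lexlt_trans : transitive lexlt.
Proof. by move=> [a b] [c d] [e f]; rewrite /lexlt /=; lia. Qed.

(** Guarantees that every monomial of a product of polynomials in [x] and in [y] with leading
    exponent in [al] also belongs to [al]. *)
Definition lower_closed al := forall J J', J \in al ->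
  (J'.1 <= J.1)%N -> (J'.2 <= J.2)%N -> J' \in al.

Lemma monicXn_add k (r : {poly R[i]}) : (size r <= k)%N ->
  'X^k + r \is monic /\ size ('X^k + r) = k.+1.
Proof.
move=> rk; have h : (size r < size ('X^k : {poly R[i]}))%N by rewrite size_polyXn.
by rewrite monicE lead_coefDl // lead_coefXn eqxx size_polyDl // size_polyXn.
Qed.

Lemma size_sum_monom (I : Type) (r : seq I) (P : pred I) (c : I -> R[i])
    (e : I -> nat) k : (forall i, P i -> (e i < k)%N) ->
  (size (\sum_(i <- r | P i) c i *: 'X^(e i) : {poly R[i]})%R <= k)%N.
Proof.
move=> h; apply: leq_trans (size_sum _ _ _) _.
elim/big_ind: _ => // [x y xk yk|i /h ik]; first by rewrite geq_max xk.
by apply: leq_trans (size_scale_leq _ _) _; rewrite size_polyXn.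
Qed.

Lemma horner_sum_monom (I : Type) (r : seq I) (P : pred I) (c : I -> R[i])
    (e : I -> nat) z :
  (\sum_(i <- r | P i) c i *: 'X^(e i)).[z] = \sum_(i <- r | P i) c i * z ^+ e i.
Proof. by rewrite horner_sum; apply: eq_bigr => i _; rewrite hornerZ hornerXn. Qed.

(* For fixed [v] the polynomial in [u] has leading coefficient [q.[v]] with [q]
   monic of degree [J.2]. *)
Lemma cheb_mono_le E F J (m : nat) (J' : nat -> nat * nat) (c : nat -> R[i]) (y : R) :
  bounded_on E id -> bounded_on F id -> (exists z, E z) -> (exists z, F z) ->
  (forall i, (i < m)%N -> lexlt (J' i) J) ->
  (forall z, (E `*` F) z ->
     cabs (cmono J z + \sum_(i < m) c i * cmono (J' i) z) <= y) ->
  cheb E ^+ J.1 * cheb F ^+ J.2 <= y.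
Proof.
move=> bE bF E0 F0 hlex hy; have [u0 Eu0] := E0; have [v0 Fv0] := F0.
have y0 : 0 <= y by apply: le_trans (hy (u0, v0) _); [exact: cabs_ge0|].
(* [q] collects the terms with the same power of [u] as the leading one; the order forces smaller
   powers of [v] in them. *)
pose q : {poly R[i]} := 'X^(J.2)
  + \sum_(i < m | (J' i).1 == J.1) c i *: 'X^((J' i).2).
have [qmon qsz] : q \is monic /\ size q = J.2.+1.
  apply: monicXn_add; apply: size_sum_monom => i /eqP e.
  by have := hlex i (ltn_ord i); rewrite /lexlt e ltnn eqxx.
have hq v : F v -> cheb E ^+ J.1 * cabs q.[v] <= y.
  move=> Fv; have [qv0|qv_neq0] := eqVneq (q.[v]) 0.
    by rewrite qv0 cabs0 mulr0.
  have qv_gt0 : 0 < cabs q.[v] by rewrite lt_def cabs_ge0 cabs_eq0 qv_neq0.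
  (* The competitor at fixed [v], divided by its leading coefficient [q.[v]]; the other terms have
     smaller degree in [u]. *)
  pose p : {poly R[i]} := 'X^(J.1)
    + \sum_(i < m | (J' i).1 != J.1) (c i * v ^+ (J' i).2 / q.[v]) *: 'X^((J' i).1).
  have [pmon psz] : p \is monic /\ size p = J.1.+1.
    apply: monicXn_add; apply: size_sum_monom => i e.
    by have := hlex i (ltn_ord i); rewrite /lexlt (negbTE e) orbF.
  rewrite -ler_pdivlMr //; apply: (cheb_le bE E0 pmon psz) => u Eu.
  rewrite ler_pdivlMr // -cabsM; apply: le_trans (hy (u, v) _) => //.
  rewrite le_eqVlt; apply/orP; left; apply/eqP; congr cabs.
  rewrite /p hornerD horner_sum_monom hornerXn mulrDl mulr_suml.
  rewrite [X in u ^+ J.1 * X]hornerD horner_sum_monom hornerXn mulrDr mulr_sumr.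
  rewrite [in RHS](bigID (fun i : 'I_m => (J' i).1 == J.1)) /= addrA.
  congr (_ + _ + _); apply: eq_bigr => i.
    by move=> /eqP e; rewrite /cmono /= e mulrCA.
  by move=> _; rewrite /cmono /=; field.
have [t0|t_neq0] := eqVneq (cheb E ^+ J.1) 0; first by rewrite t0 mul0r.
have t_gt0 : 0 < cheb E ^+ J.1 by rewrite lt_def t_neq0 exprn_ge0 ?cheb_ge0.
rewrite mulrC -ler_pdivlMr //; apply: (cheb_le bF F0 qmon qsz) => v Fv.
by rewrite ler_pdivlMr // mulrC hq.
Qed.

(** The product expands over the box of exponents below [J]. Closure puts that box in [al], the
    order puts it among the first [m.+1] entries, and the remaining entries have zero
    coefficient. *)
Lemma horner2_expansion al m (p q : {poly R[i]}) J z :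
  sorted lexlt al -> lower_closed al -> (m < size al)%N -> nth (0, 0)%N al m = J ->
  p \is monic -> size p = J.1.+1 -> q \is monic -> size q = J.2.+1 ->
  p.[z.1] * q.[z.2] = cmono J z
    + \sum_(i < m) p`_(nth (0, 0)%N al i).1 * q`_(nth (0, 0)%N al i).2
                 * cmono (nth (0, 0)%N al i) z.
Proof.
move=> srt low mal alm pmon psz qmon qsz.
pose G J' : R[i] := p`_J'.1 * q`_J'.2 * cmono J' z.
have lexP i j : (i < size al)%N -> (j < size al)%N -> (i < j)%N ->
    lexlt (nth (0, 0)%N al i) (nth (0, 0)%N al j).
  by move=> ? ?; apply: (sorted_ltn_nth lexlt_trans).
have GJ : G J = cmono J z.
  rewrite /G; move/monicP: pmon; rewrite lead_coefE psz => ->.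
  by move/monicP: qmon; rewrite lead_coefE qsz => ->; rewrite !mul1r.
have -> : cmono J z + \sum_(i < m) p`_(nth (0, 0)%N al i).1
      * q`_(nth (0, 0)%N al i).2 * cmono (nth (0, 0)%N al i) z
    = \sum_(J' <- take m.+1 al) G J'.
  rewrite (big_nth (0, 0)%N) size_take; case: ltnP => [|] hm.
    rewrite big_mkord big_ord_recr /= nth_take // alm GJ addrC; congr (_ + _).
    by apply: eq_bigr => i _; rewrite nth_take // ltnS ltnW.
  have -> : size al = m.+1 by apply/eqP; rewrite eqn_leq hm.
  rewrite big_mkord big_ord_recr /= nth_take // alm GJ addrC; congr (_ + _).
  by apply: eq_bigr => i _; rewrite nth_take // ltnS ltnW.
(* Outside the box one index exceeds the degree of [p] or [q], so the term vanishes. *)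
pose below J' := (J'.1 <= J.1)%N && (J'.2 <= J.2)%N.
rewrite (bigID below) /= [X in _ = _ + X]big1 ?addr0; last first.
  move=> J'; rewrite negb_and -!ltnNge /G => /orP[h|h].
    by rewrite (nth_default _ (_ : (size p <= J'.1)%N)) ?psz // !mul0r.
  by rewrite (nth_default _ (_ : (size q <= J'.2)%N)) ?qsz // mulr0 mul0r.
rewrite -big_filter.
have -> : p.[z.1] * q.[z.2]
    = \sum_(J' <- [seq (i, j) | i <- iota 0 J.1.+1, j <- iota 0 J.2.+1]) G J'.
  rewrite big_allpairs (horner_coef_wide (n := J.1.+1)) ?psz //.
  rewrite (horner_coef_wide (n := J.2.+1)) ?qsz // mulr_suml.
  rewrite -[iota 0 J.1.+1]/(index_iota 0 J.1.+1) big_mkord; apply: eq_bigr => i _.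
  rewrite -[iota 0 J.2.+1]/(index_iota 0 J.2.+1) big_mkord mulr_sumr; apply: eq_bigr => j _.
  by rewrite /G /cmono /=; ring.
apply: perm_big; apply: uniq_perm.
- by apply: allpairs_uniq; rewrite ?iota_uniq // => -[? ?] [? ?].
- apply/filter_uniq/take_uniq; apply: (sorted_uniq lexlt_trans) => //.
  by move=> J'; rewrite /lexlt !ltnn andbF.
move=> J'; rewrite mem_filter.
have -> : (J' \in [seq (i, j) | i <- iota 0 J.1.+1, j <- iota 0 J.2.+1]) = below J'.
  apply/allpairsP/idP => [[[i j] []]|/andP[h1 h2]].
    by rewrite !mem_iota !add0n !ltnS => /andP[_ ?] /andP[_ ?] ->; apply/andP.
  by exists J'; rewrite !mem_iota !add0n !ltnS; case: (J') h1 h2.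
case: (boolP (below J')) => //= /andP[h1 h2].
have J'al : J' \in al by apply: low h1 h2; rewrite -alm mem_nth.
have iJ' : (index J' al < size al)%N by rewrite index_mem.
(* Were [J'] listed after [J], it would be lexicographically larger, which being below [J]
   excludes. *)
have im : (index J' al <= m)%N.
  rewrite leqNgt; apply/negP => /(lexP _ _ mal iJ'); rewrite alm nth_index //.
  by rewrite /lexlt; lia.
rewrite -[X in X \in _](nth_index (0, 0)%N J'al) -(@nth_take m.+1) ?ltnS //.
by rewrite mem_nth // size_take; case: ifP => _; [exact: im|exact: iJ'].
Qed.

Lemma cmono_bounded E F J : bounded_on E id -> bounded_on F id ->
  bounded_on (E `*` F) (@cmono R J).
Proof.
move=> [M hM] [N hN]; exists (`|M| ^+ J.1 * `|N| ^+ J.2) => -[u v] [/= Eu Fv].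
rewrite /cmono cabsM !cabsX; apply: ler_pM; rewrite ?exprn_ge0 ?cabs_ge0 //.
  by apply: lerXn2r; rewrite ?nnegrE ?cabs_ge0 // (le_trans (hM u Eu)) // ler_norm.
by apply: lerXn2r; rewrite ?nnegrE ?cabs_ge0 // (le_trans (hN v Fv)) // ler_norm.
Qed.

Definition sum1 al : nat := \sum_(J <- al) J.1.
Definition sum2 al : nat := \sum_(J <- al) J.2.

Lemma prod_exp_nth al (x y : R) :
  \prod_(i < size al) (x ^+ (nth (0, 0)%N al i).1 * y ^+ (nth (0, 0)%N al i).2)
  = x ^+ sum1 al * y ^+ sum2 al.
Proof.
rewrite /sum1 /sum2 -!prodrXr -big_split /= [RHS](big_nth (0, 0)%N).
by rewrite big_mkord.
Qed.

(** By [cheb_mono_le] each adjoined monomial contributes at least its product of Chebyshev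
    powers. *)
Lemma Vmulti_lower E F al :
  bounded_on E id -> bounded_on F id -> (exists z, E z) -> (exists z, F z) ->
  sorted lexlt al ->
  cheb E ^+ sum1 al * cheb F ^+ sum2 al <= Vmulti al (E `*` F).
Proof.
move=> bE bF E0 F0 srt; rewrite -prod_exp_nth.
rewrite -[Vmulti _ _]/(maxdet (fun i => @cmono R (nth (0, 0)%N al i)) _ _).
pose t i := cheb E ^+ (nth (0, 0)%N al i).1 * cheb F ^+ (nth (0, 0)%N al i).2.
apply: (maxdet_lower (t := t)) => [i|||i ial c y hy].
- exact: cmono_bounded.
- by have [[u Eu] [v Fv]] := (E0, F0); exists (u, v).
- by move=> i; rewrite mulr_ge0 ?exprn_ge0 ?cheb_ge0.
- apply: (cheb_mono_le bE bF E0 F0 (J' := fun k => nth (0, 0)%N al k) _ hy) => k ki.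
  by apply: (sorted_ltn_nth lexlt_trans) => //; rewrite inE // (ltn_trans ki).
Qed.

(** The competitor for each exponent is a product of one-variable polynomials from [cheb_gt]. The
    constant is chosen before the list, hence uniform in [n] later. *)
Lemma Vmulti_upper E F (r s : R) :
  bounded_on E id -> bounded_on F id -> (exists z, E z) -> (exists z, F z) ->
  cheb E < r -> cheb F < s ->
  exists2 C : R, 1 <= C & forall al, sorted lexlt al -> lower_closed al ->
  Vmulti al (E `*` F) <= (size al)`!%:R * C ^+ size al * (r ^+ sum1 al * s ^+ sum2 al).
Proof.
move=> bE bF E0 F0 Er Fs.
have [C C1 hC] := cheb_gt bE Er; have [D D1 hD] := cheb_gt bF Fs.
exists (C * D); first by rewrite -[1]mulr1 ler_pM.
move=> al srt low.
have -> : (size al)`!%:R * (C * D) ^+ size al * (r ^+ sum1 al * s ^+ sum2 al)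
  = (size al)`!%:R * \prod_(i < size al)
     ((C * D) * (r ^+ (nth (0, 0)%N al i).1 * s ^+ (nth (0, 0)%N al i).2)).
  by rewrite big_split /= prodr_const card_ord prod_exp_nth -mulrA.
rewrite -[Vmulti _ _]/(maxdet (fun i => @cmono R (nth (0, 0)%N al i)) _ _).
pose t i := C * D * (r ^+ (nth (0, 0)%N al i).1 * s ^+ (nth (0, 0)%N al i).2).
apply: (maxdet_upper (s := t)) => [|i ial].
  by have [[u Eu] [v Fv]] := (E0, F0); exists (u, v).
set J := nth (0, 0)%N al i.
have [p [pmon psz hp]] := hC J.1; have [q [qmon qsz hq]] := hD J.2.
exists (fun k => p`_(nth (0, 0)%N al k).1 * q`_(nth (0, 0)%N al k).2) => z [Ez Fz].
rewrite -(horner2_expansion z srt low ial _ pmon psz qmon qsz) // cabsM /t -/J.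
rewrite mulrACA; apply: ler_pM; rewrite ?cabs_ge0 //; [exact: hp|exact: hq].
Qed.

(** * Vandermonde determinants in one variable *)

Lemma vdm_prodE n (z : 'I_n -> R[i]) :
  vdm_prod z = cabs (\det (evalmx (fun i (x : R[i]) => x ^+ i) z)).
Proof.
have -> : evalmx (fun i (x : R[i]) => x ^+ i) z = Vandermonde n (\row_j z j).
  by apply/matrixP => i j; rewrite !mxE.
rewrite det_Vandermonde cabs_prod; apply: eq_bigr => i _.
rewrite cabs_prod; apply: eq_bigr => j _.
by rewrite !mxE -cabsN opprB.
Qed.

Lemma VuniE E n : Vuni E n = maxdet (fun i (x : R[i]) => x ^+ i) E n.
Proof.
by congr sup; apply/seteqP; split=> _ [z hz <-]; exists z; rewrite ?vdm_prodE.
Qed.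

Lemma Vuni_lower E n : bounded_on E id -> (exists z, E z) ->
  cheb E ^+ (\sum_(i < n) i) <= Vuni E n.
Proof.
move=> bE E0; rewrite VuniE -prodrXr.
apply: (maxdet_lower (t := fun i => cheb E ^+ i)) => [i|||i ial c y hy] //.
- have [M hM] := bE; exists (`|M| ^+ i) => z Ez; rewrite cabsX.
  by apply: lerXn2r; rewrite ?nnegrE ?cabs_ge0 // (le_trans (hM z Ez)) // ler_norm.
- by move=> i; rewrite exprn_ge0 ?cheb_ge0.
have [|pmon psz] := @monicXn_add i (\sum_(k < i) c k *: 'X^k).
  by apply: size_sum_monom => k _.
apply: (cheb_le bE E0 pmon psz) => z Ez.
by rewrite hornerD hornerXn horner_sum_monom hy.
Qed.

Lemma Vuni_upper E (r : R) : bounded_on E id -> (exists z, E z) -> cheb E < r ->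
  exists2 C : R, 1 <= C & forall n,
  Vuni E n <= n`!%:R * C ^+ n * r ^+ (\sum_(i < n) i).
Proof.
move=> bE E0 Er; have [C C1 hC] := cheb_gt bE Er; exists C => // n.
rewrite VuniE -mulrA -prodrXr.
have -> : C ^+ n * \prod_(i < n) r ^+ i = \prod_(i < n) (C * r ^+ i).
  by rewrite big_split /= prodr_const card_ord.
apply: (maxdet_upper (s := fun i => C * r ^+ i)) => // i _.
have [p [pmon psz hp]] := hC i; exists (fun k => p`_k) => z Ez.
suff -> : z ^+ i + \sum_(k < i) p`_k * z ^+ k = p.[z] by exact: hp.
rewrite horner_coef psz big_ord_recr /= addrC.
by move/monicP: pmon; rewrite lead_coefE psz /= => ->; rewrite mul1r.
Qed.

End BidegreeLists.

(** * Asymptotics of roots *)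

Section RootAsymptotics.
Set Implicit Arguments.
Unset Strict Implicit.
Variable R : realType.

(** From [ln x = 2 * ln (sqrt x)] and [ln s <= s - 1]; enough to make [ln m / m] vanish in the
    limit. *)
Lemma ln_le_sqrt (x : R) : 0 < x -> ln x <= 2 * Num.sqrt x.
Proof.
move=> x0; have s0 : 0 < Num.sqrt x by rewrite sqrtr_gt0.
rewrite -[X in ln X](sqr_sqrtr (ltW x0)) expr2 lnM ?posrE //.
have := @le_ln1Dx R (Num.sqrt x - 1); rewrite addrCA subrr addr0.
by move=> /(_ _); lra.
Qed.

Lemma fact_le_pow (d x : nat) : (d <= x)%N -> (d`! <= x ^ d)%N.
Proof.
elim: d => // d IH dx; rewrite factS expnS leq_mul //.
by apply: IH; exact: ltnW.
Qed.

(** Since the factorial of [d] is at most [(m ^ 2) ^ d], the logarithm of the root is at most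
    [d * (2 * ln m + ln C) / l], hence at most [K * (2 * ln m + ln C) / m]. *)
Lemma cvg_root_fact (C K : R) (d m l : nat -> nat) : 1 <= C ->
  (\forall n \near \oo, [/\ (0 < l n)%N, (0 < m n)%N, (d n <= m n ^ 2)%N
     & (d n * m n)%:R <= K * (l n)%:R]) ->
  ((m n)%:R^-1) @[n --> \oo] --> (0 : R) ->
  (((d n)`!%:R * C ^+ d n) `^ ((l n)%:R^-1)) @[n --> \oo] --> (1 : R).
Proof.
move=> C1 hn hm; pose x n : R := (m n)%:R^-1.
have C0 : 0 < C by exact: lt_le_trans C1.
(* The bound on the logarithm after [ln m <= 2 * sqrt m], written in [x = 1 / m]. *)
pose b n : R := K * (4 * Num.sqrt (x n) + ln C * x n).
have b0 : b n @[n --> \oo] --> (0 : R).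
  have -> : 0 = K * (4 * Num.sqrt 0 + ln C * 0) :> R by rewrite sqrtr0; ring.
  apply: cvgMl_tmp; apply: cvgD; apply: cvgMl_tmp => //.
  by apply: (continuous_cvg _ (@sqrt_continuous R 0)).
pose w n : R := ln ((d n)`!%:R * C ^+ d n) / (l n)%:R.
have W1 n : 1 <= (d n)`!%:R * C ^+ d n.
  have := @ler_pM R 1 (d n)`!%:R 1 (C ^+ d n) ler01 ler01; rewrite mulr1.
  by apply; [rewrite ler1n fact_gt0|exact: exprn_ege1].
have w0 : w n @[n --> \oo] --> (0 : R).
  apply: (@squeeze_cvgr _ _ _ R (fun=> 0) b w _ 0 _ b0); last exact: cvg_cst.
  near=> n; have [l0 m0 dm dml] : [/\ (0 < l n)%N, (0 < m n)%N, (d n <= m n ^ 2)%N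
     & (d n * m n)%:R <= K * (l n)%:R] by near: n.
  rewrite divr_ge0 ?ln_ge0 //=; rewrite ler_pdivrMr ?ltr0n //.
  have m0R : 0 < (m n)%:R :> R by rewrite ltr0n.
  apply: (@le_trans _ _ (((d n)%:R * (2 * ln (m n)%:R) + (d n)%:R * ln C))).
    have lnX (y : R) k : 0 < y -> k%:R * ln y = ln (y ^+ k).
      by move=> y0; rewrite lnXn // mulr_natl.
    rewrite lnM ?posrE ?exprn_gt0 ?ltr0n ?fact_gt0 // -lnX // lerD2r !lnX ?exprn_gt0 //.
    rewrite ler_ln ?posrE ?exprn_gt0 ?ltr0n ?fact_gt0 //.
    by rewrite -!natrX ler_nat fact_le_pow.
  have -> : b n * (l n)%:R = (K * (l n)%:R) * (4 * Num.sqrt (x n) + ln C * x n).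
    by rewrite /b; ring.
  have x0 : 0 < x n by rewrite invr_gt0.
  apply: le_trans (ler_wpM2r _ dml); last first.
    by rewrite addr_ge0 // mulr_ge0 ?sqrtr_ge0 ?ln_ge0 // ltW.
  rewrite natrM -mulrDr -mulrA ler_wpM2l //.
  have -> : (m n)%:R * (4 * Num.sqrt (x n) + ln C * x n)
     = 4 * Num.sqrt (m n)%:R + ln C.
    have e : (m n)%:R * Num.sqrt (x n) = Num.sqrt (m n)%:R :> R.
      rewrite -[X in X * _](sqr_sqrtr (ltW m0R)) expr2 -mulrA -sqrtrM ?ler0n //.
      by rewrite /x mulfV ?gt_eqF // sqrtr1 mulr1.
    by rewrite mulrDr [_ * (4 * _)]mulrCA e mulrCA /x mulfV ?gt_eqF // mulr1.
  by rewrite lerD2r; have := ln_le_sqrt m0R; lra.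
have -> : (fun n => ((d n)`!%:R * C ^+ d n) `^ ((l n)%:R^-1)) = expR \o w.
  apply/funext => n; rewrite /= /w /powR gt_eqF ?(lt_le_trans ltr01) //.
  by rewrite mulrC.
rewrite -[1](@expR0 R); apply: continuous_cvg w0; exact: continuous_expR.
Unshelve. all: by end_near. Qed.

(** At base 0 the power jumps to 1 at exponent 0; the disjunction excludes this discontinuity. *)
Lemma cvg_powR_expo (a b : R) (x : nat -> R) : 0 <= a -> 0 < b \/ 0 < a ->
  x n @[n --> \oo] --> b -> a `^ x n @[n --> \oo] --> a `^ b.
Proof.
move=> a0 hab hx; have [a_eq0|a_neq0] := eqVneq a 0.
  case: hab => [b0|]; last by rewrite a_eq0 ltxx.
  rewrite a_eq0 powR0 ?gt_eqF //; apply: cvg_near_cst.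
  near=> n; rewrite powR0 // gt_eqF //; near: n; exact: cvgr_gt hx _ b0.
have E y : a `^ y = expR (y * ln a) by rewrite /powR (negbTE a_neq0).
under eq_cvg do rewrite E; rewrite E.
apply: (@continuous_cvg _ _ _ _ _ (fun n => x n * ln a)); first exact: continuous_expR.
exact: cvgMr_tmp.
Unshelve. all: by end_near. Qed.

Lemma powR_right_approx (a b e : R) : 0 <= a -> 0 <= b -> 0 < e ->
  exists2 r, a < r & r `^ b < a `^ b + e.
Proof.
move=> a0 b0 e0; have [->|b_neq0] := eqVneq b 0.
  by exists (a + 1); [rewrite ltrDl|rewrite !powRr0 ltrDl].
exists ((a `^ b + e / 2) `^ b^-1).
  have aE : a = (a `^ b) `^ b^-1 by rewrite -powRrM mulfV // powRr1.
  rewrite [X in X < _]aE.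
  apply: gt0_ltr_powR; rewrite ?nnegrE ?powR_ge0 ?addr_ge0 ?powR_ge0 ?divr_ge0 ?ltW //.
    by rewrite invr_gt0 lt_def b_neq0.
  by rewrite ltrDl divr_gt0.
rewrite -powRrM mulVf // powRr1 ?addr_ge0 ?powR_ge0 ?divr_ge0 ?(ltW e0) //.
by rewrite ltrD2l; lra.
Qed.

(** Shared by one and two variables: [S1] and [S2] are the total degrees in each variable, [d] the
    number of functions. The lower bound has the claimed limit, and [r], [s] close to [tau], [sig]
    bring the limit of the upper bound as near as desired. *)
Lemma cvg_root_sandwich (V : nat -> R) (d m S1 S2 : nat -> nat)
    (tau sig beta gam K : R) :
  0 <= tau -> 0 <= sig -> 0 <= beta -> 0 <= gam ->
  0 < beta \/ 0 < tau -> 0 < gam \/ 0 < sig ->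
  (forall n, tau ^+ S1 n * sig ^+ S2 n <= V n) ->
  (forall r s, tau < r -> sig < s -> exists2 C, 1 <= C & forall n,
     V n <= (d n)`!%:R * C ^+ d n * (r ^+ S1 n * s ^+ S2 n)) ->
  (\forall n \near \oo, [/\ (0 < S1 n + S2 n)%N, (0 < m n)%N, (d n <= m n ^ 2)%N
     & (d n * m n)%:R <= K * (S1 n + S2 n)%:R]) ->
  ((m n)%:R^-1) @[n --> \oo] --> (0 : R) ->
  ((S1 n)%:R / (S1 n + S2 n)%:R) @[n --> \oo] --> beta ->
  ((S2 n)%:R / (S1 n + S2 n)%:R) @[n --> \oo] --> gam ->
  V n `^ ((S1 n + S2 n)%:R^-1) @[n --> \oo] --> tau `^ beta * sig `^ gam.
Proof.
move=> tau0 sig0 beta0 gam0 tb sg hlow hup hn hm hS1 hS2.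
pose l n := (S1 n + S2 n)%N.
have rootE r s n : 0 <= r -> 0 <= s ->
    (r ^+ S1 n * s ^+ S2 n) `^ ((l n)%:R^-1)
    = r `^ ((S1 n)%:R / (l n)%:R) * s `^ ((S2 n)%:R / (l n)%:R).
  move=> r0 s0; rewrite powRM ?exprn_ge0 //.
  by rewrite -!powR_mulrn // -!powRrM.
have rootC r s : 0 <= r -> 0 <= s -> 0 < beta \/ 0 < r -> 0 < gam \/ 0 < s ->
    (r ^+ S1 n * s ^+ S2 n) `^ ((l n)%:R^-1) @[n --> \oo] --> r `^ beta * s `^ gam.
  move=> r0 s0 rb sgm; under eq_cvg do rewrite rootE //.
  by apply: cvgM; exact: cvg_powR_expo.
set L := tau `^ beta * sig `^ gam.
have V0 n : 0 <= V n by apply: le_trans (hlow n); rewrite mulr_ge0 ?exprn_ge0.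
have ler_root (x y : R) n : 0 <= x -> x <= y ->
    x `^ ((l n)%:R^-1) <= y `^ ((l n)%:R^-1).
  by move=> x0 xy; apply: ge0_ler_powR; rewrite ?nnegrE ?invr_ge0 // (le_trans x0).
have upper e : 0 < e -> exists2 r, tau < r & exists2 s, sig < s
    & r `^ beta * s `^ gam < L + e.
  move=> e0; set x := tau `^ beta; set y := sig `^ gam.
  have x0 : 0 <= x by exact: powR_ge0.
  have y0 : 0 <= y by exact: powR_ge0.
  pose k := x + y + 1; have k0 : 0 < k by rewrite /k; lra.
  (* With [t <= 1] and [t * (x + y + 1) <= e], the product [(x + t) * (y + t)] is at most
     [x * y + e]. *)
  pose t := Num.min 1 (e / k).
  have t0 : 0 < t by rewrite lt_min ltr01 divr_gt0.
  have t1 : t <= 1 by rewrite ge_min lexx.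
  have tk : t * k <= e by rewrite -ler_pdivlMr // ge_min lexx orbT.
  have [r taur hr] := powR_right_approx tau0 beta0 t0.
  have [s sigs hs] := powR_right_approx sig0 gam0 t0.
  exists r => //; exists s => //.
  have : r `^ beta * s `^ gam < (x + t) * (y + t).
    by apply: ltr_pM; rewrite ?powR_ge0.
  by rewrite /L -/x -/y; move: tk; rewrite /k => tk ?; nra.
apply/cvgrPdist_lt => e e0.
have [r taur [s sigs rsL]] := upper _ e0.
have r0 : 0 < r by exact: le_lt_trans taur.
have s0 : 0 < s by exact: le_lt_trans sigs.
have [C C1 hC] := hup _ _ taur sigs.
have hU : ((d n)`!%:R * C ^+ d n) `^ ((l n)%:R^-1)
    * (r ^+ S1 n * s ^+ S2 n) `^ ((l n)%:R^-1) @[n --> \oo]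
    --> 1 * (r `^ beta * s `^ gam).
  apply: cvgM; first exact: cvg_root_fact C1 hn hm.
  by apply: rootC; rewrite ?ltW //; right.
rewrite mul1r in hU.
have hL := rootC _ _ tau0 sig0 tb sg.
near=> n.
have h1 : V n `^ ((l n)%:R^-1) < L + e.
  apply: (@le_lt_trans _ _ (((d n)`!%:R * C ^+ d n) `^ ((l n)%:R^-1)
    * (r ^+ S1 n * s ^+ S2 n) `^ ((l n)%:R^-1))); last first.
    near: n; exact: cvgr_lt hU _ rsL.
  rewrite -powRM ?mulr_ge0 ?exprn_ge0 ?ler0n ?(ltW r0) ?(ltW s0) ?(le_trans ler01) //.
  exact: ler_root.
have h2 : L - e < V n `^ ((l n)%:R^-1).
  apply: (@lt_le_trans _ _ ((tau ^+ S1 n * sig ^+ S2 n) `^ ((l n)%:R^-1))).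
    near: n; apply: cvgr_gt hL _ _; rewrite -/L; lra.
  by apply: ler_root; rewrite ?mulr_ge0 ?exprn_ge0.
by rewrite ltr_norml; move: h1 h2; rewrite /l; lra.
Unshelve. all: by end_near. Qed.

End RootAsymptotics.

(** * Lattice points of a dilated triangle *)

Section LatticeCounting.
Set Implicit Arguments.
Unset Strict Implicit.
Variable R : realType.
Implicit Types (a b : R) (n : nat).

Definition tri_exps a b n := lattice_exps (triangle a b) (tri_box a b n) n.

Lemma scaleset_triangle a b n (J : nat * nat) : 0 < a -> 0 < b ->
  `[< scaleset n (triangle a b) (J.1%:R, J.2%:R) >]
  = (J.1%:R / b + J.2%:R / a <= n%:R).
Proof.
move=> a0 b0; apply/asboolP/idP => [[[x y] /= [x0 [y0 xy]] [<- <-]]|h].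
  by rewrite -!mulrA -mulrDr ler_piMr.
(* For [n = 0] rescaling by [1 / n] is impossible; there the inequality leaves only the origin. *)
have [n0|n0] := eqVneq n 0%N; last first.
  exists (J.1%:R / n%:R, J.2%:R / n%:R); rewrite /triangle /=.
    split; first by rewrite divr_ge0.
    split; first by rewrite divr_ge0.
    by rewrite ![_ / n%:R / _]mulrAC -mulrDl ler_pdivrMr ?mul1r // ltr0n lt0n.
  by rewrite !mulrA ![n%:R * _]mulrC !mulfK // pnatr_eq0.
have : J.1%:R / b + J.2%:R / a = 0.
  apply/eqP; rewrite eq_le addr_ge0 ?divr_ge0 ?(ltW a0) ?(ltW b0) // andbT.
  by rewrite -[X in _ <= X](_ : n%:R = 0) // n0.
move/eqP; rewrite paddr_eq0 ?divr_ge0 ?(ltW a0) ?(ltW b0) //.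
rewrite !mulf_eq0 !invr_eq0 (gt_eqF a0) (gt_eqF b0) !orbF !pnatr_eq0 => /andP[/eqP -> /eqP ->].
by exists (0, 0) => /=; rewrite ?n0 ?mul0r // /triangle /= !mul0r addr0 lexx ler01.
Qed.

Lemma tri_box_gt1 a b n (i j : nat) : 0 < a -> 0 < b ->
  i%:R / b + j%:R / a <= n%:R -> (i < tri_box a b n)%N.
Proof.
move=> a0 b0 h; rewrite ltnS truncn_ge_nat ?mulr_ge0 ?addr_ge0 ?(ltW a0) ?(ltW b0) //.
have : i%:R / b <= n%:R by apply: le_trans h; rewrite lerDl divr_ge0 // ltW.
rewrite ler_pdivrMr // => h'; apply: le_trans h' _.
by rewrite ler_wpM2l // lerDr ltW.
Qed.

Lemma tri_boxC a b : tri_box a b = tri_box b a.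
Proof. by apply/funext => n; rewrite /tri_box addrC. Qed.

Lemma tri_box_gt2 a b n (i j : nat) : 0 < a -> 0 < b ->
  i%:R / b + j%:R / a <= n%:R -> (j < tri_box a b n)%N.
Proof. by move=> a0 b0; rewrite addrC tri_boxC; exact: tri_box_gt1. Qed.

Lemma mem_tri_exps a b n (J : nat * nat) : 0 < a -> 0 < b ->
  (J \in tri_exps a b n) = (J.1%:R / b + J.2%:R / a <= n%:R).
Proof.
move=> a0 b0; rewrite mem_filter scaleset_triangle //.
apply/andP/idP => [[]//|h]; split => //.
apply/allpairsP; exists J; rewrite !mem_iota !add0n !leq0n; split.
- exact: tri_box_gt1 h.
- exact: tri_box_gt2 h.
- by case: (J).
Qed.

Lemma lower_closed_tri_exps a b n : 0 < a -> 0 < b -> lower_closed (tri_exps a b n).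
Proof.
move=> a0 b0 J J'; rewrite !mem_tri_exps // => h h1 h2; apply: le_trans h.
by apply: lerD; rewrite ler_pM2r ?invr_gt0 // ler_nat.
Qed.

Lemma pairwise_lex_pairs (s t : seq nat) : pairwise ltn s -> pairwise ltn t ->
  pairwise lexlt [seq (i, j) | i <- s, j <- t].
Proof.
move=> + tt; elim: s => //= i s IH /andP[/allP is_ /IH h].
rewrite pairwise_cat h andbT pairwise_map; apply/andP; split.
  apply/allrelP => _ _ /mapP[j _ ->] /allpairsP[[i' j'] [/= i's _ ->]].
  by have /= ii' := is_ _ i's; rewrite /lexlt /= ii'.
by apply: sub_pairwise tt => j j'; rewrite /lexlt /= eqxx ltnn.
Qed.

Lemma sorted_lattice_exps (C : set (R * R)) (B n : nat) :
  sorted lexlt (lattice_exps C B n).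
Proof.
apply: (sorted_filter lexlt_trans); rewrite (sorted_pairwise lexlt_trans).
by apply: pairwise_lex_pairs; rewrite -sorted_pairwise ?iota_ltn_sorted //; exact: ltn_trans.
Qed.

Lemma size_tri_exps a b n : (size (tri_exps a b n) <= tri_box a b n ^ 2)%N.
Proof.
rewrite size_filter; apply: leq_trans (count_size _ _) _.
by rewrite size_allpairs !size_iota.
Qed.

Lemma sum_tri_exps a b n (f : nat * nat -> nat) : 0 < a -> 0 < b ->
  (\sum_(J <- tri_exps a b n) f J = \sum_(i < tri_box a b n)
     \sum_(j < tri_box a b n | (i%:R / b + j%:R / a <= n%:R)%R) f (i : nat, j : nat))%N.
Proof.
move=> a0 b0; rewrite big_filter big_mkcond big_allpairs.
rewrite -[iota _ _]/(index_iota 0 (tri_box a b n)) big_mkord.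
apply: eq_bigr => i _; rewrite big_mkord [RHS]big_mkcond.
by apply: eq_bigr => j _; rewrite scaleset_triangle.
Qed.

(** Reflection in the diagonal exchanges the two triangles and preserves the box, so only first
    coordinates need be counted. *)
Lemma sum2_tri_exps a b n : 0 < a -> 0 < b ->
  sum2 (tri_exps a b n) = sum1 (tri_exps b a n).
Proof.
move=> a0 b0; rewrite /sum1 /sum2 !sum_tri_exps // tri_boxC.
under eq_bigr do rewrite big_mkcond.
rewrite exchange_big /=; apply: eq_bigr => i _.
by rewrite [RHS]big_mkcond; apply: eq_bigr => j _; rewrite addrC.
Qed.

Definition tri_cols b n : nat := (Num.truncn (b * n%:R)).+1.

Lemma tri_colsP b n (i : nat) : 0 < b -> (i < tri_cols b n)%N = (i%:R / b <= n%:R).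
Proof.
move=> b0; rewrite ltnS truncn_ge_nat ?mulr_ge0 ?(ltW b0) //.
by rewrite ler_pdivrMr // mulrC.
Qed.

(** Counting by columns: column [i] meets the triangle up to height [a * (n - i / b)], and each of
    its points contributes [i]. *)
Lemma sum1_tri_exps a b n : 0 < a -> 0 < b ->
  sum1 (tri_exps a b n) = (\sum_(i < tri_cols b n)
     i * (Num.truncn (a * (n%:R - i%:R / b))%R).+1)%N.
Proof.
move=> a0 b0; rewrite /sum1 sum_tri_exps //=.
have colB : (tri_cols b n <= tri_box a b n)%N.
  by rewrite ltnS le_truncn // mulrC ler_wpM2l // lerDr ltW.
rewrite (big_ord_widen _ (fun i => i * (Num.truncn (a * (n%:R - i%:R / b))%R).+1)%N colB).
rewrite [RHS]big_mkcond; apply: eq_bigr => i _; rewrite tri_colsP //.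
case: ifP => [ib|ib]; last first.
  apply: big_pred0 => j; apply/negP => h; move/negP: ib; apply.
  by apply: le_trans h; rewrite lerDl divr_ge0 // ltW.
set y := a * (n%:R - i%:R / b).
have y0 : 0 <= y by rewrite mulr_ge0 ?subr_ge0 // ltW.
have yB : ((Num.truncn y).+1 <= tri_box a b n)%N.
  rewrite ltnS le_truncn // /y mulrC; apply: ler_pM; rewrite ?subr_ge0 ?(ltW a0) //.
    by rewrite lerBlDr lerDl divr_ge0 // ltW.
  by rewrite lerDl ltW.
rewrite -[X in _ = (_ * X)%N]card_ord mulnC -sum_nat_const.
rewrite (big_ord_widen _ (fun=> nat_of_ord i) yB); apply: eq_bigl => j.
by rewrite ltnS truncn_ge_nat // /y [a * _]mulrC -ler_pdivrMr // lerBrDr addrC.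
Qed.

Lemma sum_ordE (M : nat) : \sum_(i < M) (i%:R : R) = M%:R * (M%:R - 1) / 2.
Proof.
elim: M => [|M IH]; first by rewrite big_ord0 !mul0r.
by rewrite big_ord_recr /= IH -natr1; field.
Qed.

Lemma sum_sqr_ordE (M : nat) :
  \sum_(i < M) (i%:R * i%:R : R) = (M%:R - 1) * M%:R * (2 * M%:R - 1) / 6.
Proof.
elim: M => [|M IH]; first by rewrite big_ord0; field.
by rewrite big_ord_recr /= IH -natr1; field.
Qed.

(** A column of height [h] has between [h] and [h + 1] points. [P] is the sum of [i * h] in closed
    form, and the error is at most the sum of the [i]. *)
Lemma sum1_bounds a b n (M P : R) : 0 < a -> 0 < b -> M = (tri_cols b n)%:R ->
  P = a * n%:R * (M * (M - 1) / 2) - a / b * ((M - 1) * M * (2 * M - 1) / 6) ->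
  P <= (sum1 (tri_exps a b n))%:R <= P + M * (M - 1) / 2.
Proof.
move=> a0 b0 ME PE0; rewrite sum1_tri_exps // natr_sum.
have PE : P = \sum_(i < tri_cols b n) (i%:R * (a * (n%:R - i%:R / b))).
  rewrite PE0 ME -sum_ordE -sum_sqr_ordE !mulr_sumr -sumrB.
  by apply: eq_bigr => i _; ring.
have bnd (i : 'I_(tri_cols b n)) :
    (Num.truncn (a * (n%:R - i%:R / b)))%:R <= a * (n%:R - i%:R / b)
      <= (Num.truncn (a * (n%:R - i%:R / b))).+1%:R.
  have y0 : 0 <= a * (n%:R - i%:R / b).
    by rewrite mulr_ge0 ?subr_ge0 ?(ltW a0) // -tri_colsP.
  by have /andP[-> /ltW ->] := truncn_itv y0.
apply/andP; split.
  rewrite PE; apply: ler_sum => i _; rewrite natrM ler_wpM2l //.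
  by have /andP[] := bnd i.
rewrite PE ME -sum_ordE -big_split /=; apply: ler_sum => i _; rewrite natrM -natr1.
rewrite mulrDr mulr1 lerD2r ler_wpM2l //.
by have /andP[] := bnd i.
Qed.

Lemma cvg_invn : (n%:R^-1 : R) @[n --> \oo] --> (0 : R).
Proof.
apply/(gtr0_cvgV0 _); last exact: cvgr_idn.
by near=> n; rewrite ltr0n; near: n; exact: nbhs_infty_gt.
Unshelve. all: by end_near. Qed.

Lemma cvg_truncn_div (c : R) : 0 <= c ->
  ((Num.truncn (n%:R * c)).+1%:R / n%:R : R) @[n --> \oo] --> c.
Proof.
move=> c0.
have h : (c + n%:R^-1) @[n --> \oo] --> c.
  by rewrite -[X in _ --> X]addr0; apply: cvgD cvg_invn; exact: cvg_cst.
apply: (@squeeze_cvgr _ _ _ R (fun=> c) (fun n => c + n%:R^-1) _ _ c _ h); last exact: cvg_cst.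
near=> n; have n0 : 0 < n%:R :> R by rewrite ltr0n; near: n; exact: nbhs_infty_gt.
have y0 : 0 <= n%:R * c by rewrite mulr_ge0.
have /andP[h1 /ltW h2] := truncn_itv y0.
rewrite ler_pdivlMr // mulrC h2 ler_pdivrMr // mulrDl mulVf ?gt_eqF // -natr1.
by rewrite lerD2r [c * _]mulrC h1.
Unshelve. all: by end_near. Qed.

Lemma cvg_sum1 a b : 0 < a -> 0 < b ->
  ((sum1 (tri_exps a b n))%:R / n%:R ^+ 3 : R) @[n --> \oo] --> a * b ^+ 2 / 6.
Proof.
move=> a0 b0; pose mu n : R := (tri_cols b n)%:R / n%:R; pose nu n : R := n%:R^-1.
have hmu : mu n @[n --> \oo] --> b.
  rewrite /mu /tri_cols; under eq_cvg do rewrite mulrC [b * _]mulrC mulrC.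
  by apply: cvg_truncn_div; exact: ltW.
have hnu : nu n @[n --> \oo] --> (0 : R) := cvg_invn.
(* [A] and [B] are [P] and the error term of [sum1_bounds] divided by the cube of [n], as
   polynomials in [mu] and [nu]. *)
pose A n := a * (mu n * (mu n - nu n) / 2)
     - a / b * ((mu n - nu n) * mu n * (2 * mu n - nu n) / 6).
pose B n := nu n * (mu n * (mu n - nu n) / 2).
have hmn : mu n - nu n @[n --> \oo] --> b - 0 by exact: cvgB.
have h2mn : 2 * mu n - nu n @[n --> \oo] --> 2 * b - 0.
  by apply: cvgB hnu; exact: cvgMl_tmp.
have hA : A n @[n --> \oo] --> a * (b * (b - 0) / 2) - a / b * ((b - 0) * b * (2 * b - 0) / 6).
  apply: cvgB; apply: cvgMl_tmp; apply: cvgMr_tmp; first exact: cvgM.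
  by apply: cvgM h2mn; exact: cvgM.
have hB : B n @[n --> \oo] --> 0 * (b * (b - 0) / 2).
  by apply: cvgM hnu _; apply: cvgMr_tmp; exact: cvgM.
have LE : a * (b * (b - 0) / 2) - a / b * ((b - 0) * b * (2 * b - 0) / 6) = a * b ^+ 2 / 6.
  by field; rewrite gt_eqF.
rewrite LE in hA.
have hAB : A n + B n @[n --> \oo] --> a * b ^+ 2 / 6.
  by rewrite -[X in _ --> X]addr0 -[X in _ --> _ + X](mul0r (b * (b - 0) / 2)); exact: cvgD.
apply: (@squeeze_cvgr _ _ _ R A (fun n => A n + B n) _ _ _ hA hAB).
near=> n; have n0 : 0 < n%:R :> R by rewrite ltr0n; near: n; exact: nbhs_infty_gt.
have /andP[h1 h2] := sum1_bounds a0 b0 (erefl (tri_cols b n)%:R) (erefl _).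
have n30 : 0 < n%:R ^+ 3 :> R by rewrite exprn_gt0.
have nn0 : n%:R != 0 :> R by rewrite gt_eqF.
have bn0 : b != 0 by rewrite gt_eqF.
apply/andP; split.
  rewrite ler_pdivlMr //; apply: le_trans h1; rewrite le_eqVlt; apply/orP; left; apply/eqP.
  by rewrite /A /mu /nu; field; rewrite nn0 bn0.
rewrite ler_pdivrMr //; apply: le_trans h2 _; rewrite le_eqVlt; apply/orP; left; apply/eqP.
by rewrite /A /B /mu /nu; field; rewrite nn0 bn0.
Unshelve. all: by end_near. Qed.

Lemma cvg_sum2 a b : 0 < a -> 0 < b ->
  ((sum2 (tri_exps a b n))%:R / n%:R ^+ 3 : R) @[n --> \oo] --> b * a ^+ 2 / 6.
Proof.
move=> a0 b0; have E n := sum2_tri_exps n a0 b0.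
by under eq_cvg do rewrite E; exact: cvg_sum1.
Qed.

Lemma lsum_split al : lsum al = (sum1 al + sum2 al)%N.
Proof. exact: big_split. Qed.

Lemma cvg_lsum a b : 0 < a -> 0 < b ->
  ((lsum (tri_exps a b n))%:R / n%:R ^+ 3 : R) @[n --> \oo] --> a * b * (a + b) / 6.
Proof.
move=> a0 b0; under eq_cvg do rewrite lsum_split natrD mulrDl.
have -> : a * b * (a + b) / 6 = a * b ^+ 2 / 6 + b * a ^+ 2 / 6 by field.
by apply: cvgD; [exact: cvg_sum1|exact: cvg_sum2].
Qed.

Lemma near_eq_cvgn (f g : nat -> R) (l : R) : (\forall n \near \oo, f n = g n) ->
  f n @[n --> \oo] --> l -> g n @[n --> \oo] --> l.
Proof. by move=> fg hf; apply: cvg_trans hf; apply: near_eq_cvg. Qed.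

Lemma cvg_sum_ratio (f : nat -> nat) a b (c : R) : 0 < a -> 0 < b ->
  ((f n)%:R / n%:R ^+ 3 : R) @[n --> \oo] --> c ->
  ((f n)%:R / (lsum (tri_exps a b n))%:R : R) @[n --> \oo]
    --> c / (a * b * (a + b) / 6).
Proof.
move=> a0 b0 hf; have ab0 : 0 < a * b * (a + b) / 6.
  by rewrite divr_gt0 ?mulr_gt0 ?addr_gt0.
apply: (@near_eq_cvgn (fun n => (f n)%:R / n%:R ^+ 3
    * ((lsum (tri_exps a b n))%:R / n%:R ^+ 3)^-1)); last first.
  exact: cvgM hf (cvgV (lt0r_neq0 ab0) (cvg_lsum a0 b0)).
near=> n => /=.
have n0 : n%:R != 0 :> R by rewrite pnatr_eq0 -lt0n; near: n; exact: nbhs_infty_gt.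
by rewrite invf_div mulrA divfK // expf_neq0.
Unshelve. all: by end_near. Qed.

Lemma cvg_sum1_ratio a b : 0 < a -> 0 < b ->
  ((sum1 (tri_exps a b n))%:R / (lsum (tri_exps a b n))%:R : R) @[n --> \oo]
    --> b / (a + b).
Proof.
move=> a0 b0; have -> : b / (a + b) = (a * b ^+ 2 / 6) / (a * b * (a + b) / 6).
  by field; rewrite !gt_eqF // addr_gt0.
by apply: cvg_sum_ratio => //; exact: cvg_sum1.
Qed.

Lemma cvg_sum2_ratio a b : 0 < a -> 0 < b ->
  ((sum2 (tri_exps a b n))%:R / (lsum (tri_exps a b n))%:R : R) @[n --> \oo]
    --> a / (a + b).
Proof.
move=> a0 b0; have -> : a / (a + b) = (b * a ^+ 2 / 6) / (a * b * (a + b) / 6).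
  by field; rewrite !gt_eqF // addr_gt0.
by apply: cvg_sum_ratio => //; exact: cvg_sum2.
Qed.

Lemma cvg_inv_tri_box a b : 0 < a -> 0 < b ->
  ((tri_box a b n)%:R^-1 : R) @[n --> \oo] --> (0 : R).
Proof.
move=> a0 b0; have ab0 : 0 < a + b by exact: addr_gt0.
apply: (@near_eq_cvgn (fun n => n%:R^-1 * ((tri_box a b n)%:R / n%:R)^-1)); last first.
  rewrite -[X in _ --> X](mul0r (a + b)^-1).
  exact: cvgM cvg_invn (cvgV (lt0r_neq0 ab0) (cvg_truncn_div (ltW ab0))).
near=> n => /=.
have n0 : n%:R != 0 :> R by rewrite pnatr_eq0 -lt0n; near: n; exact: nbhs_infty_gt.
by rewrite invf_div mulrA mulVf // mul1r.
Unshelve. all: by end_near. Qed.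

(** The number of exponents times the box side is at most the cube of the side, which has the same
    order as [lsum]. *)
Lemma tri_exps_growth a b : 0 < a -> 0 < b -> exists K : R, \forall n \near \oo,
  [/\ (0 < lsum (tri_exps a b n))%N, (0 < tri_box a b n)%N,
      (size (tri_exps a b n) <= tri_box a b n ^ 2)%N
    & (size (tri_exps a b n) * tri_box a b n)%:R
        <= K * (lsum (tri_exps a b n))%:R].
Proof.
move=> a0 b0; have ab0 : 0 < a + b by exact: addr_gt0.
have c0 : 0 < a * b * (a + b) / 6 by rewrite divr_gt0 ?mulr_gt0.
have hbox : ((tri_box a b n ^ 3)%:R / n%:R ^+ 3 : R) @[n --> \oo] --> (a + b) ^+ 3.
  have h := cvg_truncn_div (ltW ab0).
  apply: near_eq_cvgn (cvgM h (cvgM h h)); near=> n => /=.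
  by rewrite natrX -expr_div_n exprS expr2.
have hratio := cvg_sum_ratio a0 b0 hbox.
set K0 := (X in _ --> X) in hratio; exists (K0 + 1).
near=> n; have n0 : 0 < n%:R :> R by rewrite ltr0n; near: n; exact: nbhs_infty_gt.
have l0 : 0 < (lsum (tri_exps a b n))%:R :> R.
  suff : 0 < (lsum (tri_exps a b n))%:R / n%:R ^+ 3 :> R.
    by rewrite pmulr_lgt0 // invr_gt0 exprn_gt0.
  by near: n; exact: cvgr_gt (cvg_lsum a0 b0) _ c0.
split => //; [by rewrite -(ltr0n R)|exact: size_tri_exps|].
apply: (@le_trans _ _ (tri_box a b n ^ 3)%:R).
  by rewrite ler_nat expnSr leq_mul2r size_tri_exps orbT.
rewrite -ler_pdivrMr //; apply: ltW; near: n; apply: cvgr_lt hratio _ _.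
by rewrite ltrDl.
Unshelve. all: by end_near. Qed.

End LatticeCounting.

(** * Transfinite diameters *)

Section TransfiniteDiameters.
Set Implicit Arguments.
Unset Strict Implicit.
Variable R : realType.
Implicit Types (E F : set R[i]) (a b : R).

Lemma ccompact_bounded E : ccompact E -> bounded_on E id.
Proof.
(* The max norm of the pair is at most [M + 1], and the modulus is at most the sum of the two
   absolute values. *)
move=> /compact_bounded[M [_ hM]]; exists (2 * (M + 1)) => z Ez.
have := hM (M + 1) _ (complex.Re z, complex.Im z) _.
rewrite ltrDl ltr01 => /(_ isT (ex_intro2 _ _ z Ez erefl)).
rewrite /= prod_normE /= ge_max => /andP[h1 h2].
apply: (@le_trans _ _ (`|complex.Re z| + `|complex.Im z|)); last by lra.
rewrite -[X in _ <= X]ger0_norm ?addr_ge0 // -sqrtr_sqr ler_sqrt ?sqr_ge0 //.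
rewrite sqrrD !real_normK ?num_real // lerD2r lerDl.
by rewrite mulrn_wge0 ?mulr_ge0.
Qed.

Lemma limn_esup_EFin (u : nat -> R) (l : R) : u n @[n --> \oo] --> l ->
  limn_esup (fun n => (u n)%:E) = l%:E.
Proof.
move=> ul; apply: (cvg_limn_einf_sup _).2; apply: cvg_EFin => //.
by near=> n.
Unshelve. all: by end_near. Qed.

(** The classical equality of transfinite diameter and Chebyshev constant, as the sandwich with
    trivial second variable: base 1, exponents 0. *)
Lemma tdiam_cheb E : bounded_on E id -> (exists z, E z) -> tdiam E = (cheb E)%:E.
Proof.
move=> bE E0; apply: limn_esup_EFin.
pose S n := (\sum_(i < n) i)%N.
have SE n : (S n * 2)%N = (n * (n - 1))%N.
  rewrite /S; elim: n => [|n IH]; first by rewrite big_ord0.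
  by rewrite big_ord_recr /= mulnDl IH; case: n {IH} => [|n]; rewrite ?subn1 /=; nia.
have expE n : 2 / (n * (n - 1))%:R = (S n + 0)%N%:R^-1 :> R.
  by rewrite addn0 -SE natrM invfM mulrCA divff ?mulr1 // pnatr_eq0.
under eq_cvg do rewrite expE.
have -> : cheb E = cheb E `^ 1 * 1 `^ 0 by rewrite powRr0 mulr1 powRr1 ?cheb_ge0.
(* [K = 4] suffices because [n ^ 2 <= 2 * n * (n - 1)] once [n >= 2]. *)
apply: (cvg_root_sandwich (d := id) (m := id) (S2 := fun=> 0%N) (K := 4)) => //.
- exact: cheb_ge0.
- by left.
- by right.
- by move=> n; rewrite expr0 mulr1; exact: Vuni_lower.
- move=> r s Er _; have [C C1 hC] := Vuni_upper bE E0 Er; exists C => // n.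
  by rewrite expr0 mulr1 hC.
- near=> n; have n2 : (1 < n)%N by near: n; exact: nbhs_infty_gt.
  have n1 : (n = (n - 1).+1)%N by lia.
  have SnE : (n * n <= 4 * (S n + 0))%N.
    have := SE n; nia.
  split; [by have := SE n; nia|lia|nia|].
  by rewrite -[4]/(4%:R) -natrM ler_nat.
- exact: cvg_invn.
- apply: (@near_eq_cvgn R (fun=> 1)); last exact: cvg_cst.
  near=> n; rewrite addn0 divff // pnatr_eq0 -lt0n.
  have n2 : (1 < n)%N by near: n; exact: nbhs_infty_gt.
  by have := SE n; rewrite /S; nia.
- by under eq_cvg do rewrite mul0r; exact: cvg_cst.
Unshelve. all: by end_near. Qed.

Lemma deltaC_cheb E F a b : bounded_on E id -> bounded_on F id ->
  (exists z, E z) -> (exists z, F z) -> 0 < a -> 0 < b ->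
  deltaC (triangle a b) (tri_box a b) (E `*` F)
  = (cheb E `^ (b / (a + b)) * cheb F `^ (a / (a + b)))%:E.
Proof.
move=> bE bF E0 F0 a0 b0; apply: limn_esup_EFin.
have ab0 : 0 < a + b by exact: addr_gt0.
have [K hK] := tri_exps_growth a0 b0.
under eq_cvg do rewrite lsum_split.
apply: (cvg_root_sandwich (d := fun n => size (tri_exps a b n)) (m := tri_box a b)
  (K := K)).
- exact: cheb_ge0.
- exact: cheb_ge0.
- by rewrite divr_ge0 ?ltW.
- by rewrite divr_ge0 ?ltW.
- by left; rewrite divr_gt0.
- by left; rewrite divr_gt0.
- by move=> n; apply: Vmulti_lower => //; exact: sorted_lattice_exps.
- move=> r s Er Fs; have [C C1 hC] := Vmulti_upper bE bF E0 F0 Er Fs.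
  exists C => // n; apply: hC; first exact: sorted_lattice_exps.
  exact: lower_closed_tri_exps.
- by near=> n; rewrite -lsum_split; near: n; exact: hK.
- exact: cvg_inv_tri_box.
- by under eq_cvg do rewrite -lsum_split; exact: cvg_sum1_ratio.
- by under eq_cvg do rewrite -lsum_split; exact: cvg_sum2_ratio.
Unshelve. all: by end_near. Qed.

(** No tuple exists, so the supremum takes its default value 0; for [m = 0] the empty tuple would
    give 1. *)
Lemma maxdet_set0 (T : Type) (f : nat -> T -> R[i]) m : (0 < m)%N ->
  maxdet f set0 m = 0.
Proof.
case: m => // m _; rewrite /maxdet.
rewrite (_ : [set zeta : 'I_m.+1 -> T | _] = set0) ?image_set0 ?sup0 //.
by apply/seteqP; split=> // zeta /(_ ord0).
Qed.

Lemma tdiam_set0 : tdiam (set0 : set R[i]) = 0%E.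
Proof.
apply: limn_esup_EFin; apply: (@near_eq_cvgn R (fun=> 0)); last exact: cvg_cst.
near=> n; have n2 : (1 < n)%N by near: n; exact: nbhs_infty_gt.
rewrite VuniE maxdet_set0 ?(ltnW n2) // powR0 // mulf_neq0 ?invr_eq0 // pnatr_eq0.
by rewrite muln_eq0 subn_eq0; lia.
Unshelve. all: by end_near. Qed.

Lemma deltaC_set0 a b : 0 < a -> 0 < b ->
  deltaC (triangle a b) (tri_box a b) (set0 : set (R[i] * R[i])) = 0%E.
Proof.
move=> a0 b0; have [K hK] := tri_exps_growth a0 b0.
apply: limn_esup_EFin; apply: (@near_eq_cvgn R (fun=> 0)); last exact: cvg_cst.
near=> n.
have [l0 _ _ _] : [/\ (0 < lsum (tri_exps a b n))%N, (0 < tri_box a b n)%N,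
      (size (tri_exps a b n) <= tri_box a b n ^ 2)%N
    & (size (tri_exps a b n) * tri_box a b n)%:R
        <= K * (lsum (tri_exps a b n))%:R] by near: n; exact: hK.
have s0 : (0 < size (tri_exps a b n))%N.
  by move: l0; rewrite /lsum; case: (tri_exps a b n) => //; rewrite big_nil.
rewrite -[Vmulti _ _]/(maxdet (fun i => @cmono R (nth (0, 0)%N (tri_exps a b n) i)) set0
  (size (tri_exps a b n))) maxdet_set0 // powR0 // invr_eq0 pnatr_eq0 -lt0n.
exact: l0.
Unshelve. all: by end_near. Qed.

End TransfiniteDiameters.

Theorem theorem4p1 (R : realType) (E F : set R[i]) (a b : R) :
  ccompact E -> ccompact F -> 0 < a -> 0 < b ->
  deltaC (triangle a b) (tri_box a b) (E `*` F) =
  (tdiam E `^ (b / (a + b)) * tdiam F `^ (a / (a + b)))%E.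
Proof.
move=> /ccompact_bounded bE /ccompact_bounded bF a0 b0.
have ab0 : 0 < a + b by exact: addr_gt0.
have bab : b / (a + b) != 0 by rewrite gt_eqF ?divr_gt0.
have aab : a / (a + b) != 0 by rewrite gt_eqF ?divr_gt0.
(* With an empty factor both sides are 0, the exponents being nonzero; [cheb] is used only for
   nonempty sets. *)
have [->|/set0P E0] := eqVneq E set0.
  by rewrite set0X deltaC_set0 // tdiam_set0 poweR_EFin powR0 // mul0e.
have [->|/set0P F0] := eqVneq F set0.
  by rewrite setX0 deltaC_set0 // tdiam_set0 poweR_EFin powR0 // mule0.
by rewrite deltaC_cheb // !tdiam_cheb // !poweR_EFin EFinM.
Qed.
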